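(* Let $S$ be a locally compact Hausdorff space with its Borel $\sigma$-algebra $\mathscr{S}$, let $n\le N$ be positive integers, and let $X=(X_1,\ldots,X_n)$ be an exchangeable random element of $S^n$ such that the law of $X_1$ is outer regular and tight. Then $X$ is $N$-extendible if and only if $\|\mathcal E^N_n\|=1$, where \[ \|\mathcal E^N_n\| := \sup\Big\{ |\mathbb{E}\, g(X_1,\ldots,X_n)| :\ g:S^n\to\mathbb{R} \text{ bounded measurable},\ |U^N_n g(x)|\le 1 \text{ for all } x\in S^N\Big\}. \]
   Context: $S^n$ carries the product $\sigma$-algebra $\mathscr{S}^n$. A random element $(X_1,\ldots,X_n)$ of $S^n$ is exchangeable if its law is invariant under all $n!$ permutations of coordinates. For $N\ge n$, $X$ is $N$-extendible if there is an exchangeable random element $(Y_1,\ldots,Y_N)$ of $S^N$ with $(Y_1,\ldots,Y_n)$ equal in distribution to $(X_1,\ldots,X_n)$. $\mathfrak S[n,N]$ is the set of injections $\{1,\ldots,n\}\to\{1,\ldots,N\}$, $(N)_n=N(N-1)\cdots(N-n+1)=|\mathfrak S[n,N]|$, and for $g:S^n\to\mathbb{R}$, $U^N_n g(x_1,\ldots,x_N)=\frac{1}{(N)_n}\sum_{\sigma\in\mathfrak S[n,N]} g(x_{\sigma(1)},\ldots,x_{\sigma(n)})$. A probability measure $P$ on $S$ is tight if for every $\epsilon>0$ there is a compact $K$ with $P(K)\ge 1-\epsilon$, and outer regular if $P(A)=\inf\{P(O): O\supset A \text{ open}\}$ for all $A\in\mathscr{S}$. *)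

(* Defs.v *)
From HB Require Import structures.
From mathcomp Require Import all_boot all_order all_fingroup all_algebra.
From mathcomp Require Import all_classical all_reals all_analysis.

Set Implicit Arguments.
Unset Strict Implicit.
Unset Printing Implicit Defensive.

Import Order.TTheory GRing.Theory Num.Theory.
Import numFieldNormedType.Exports.

Local Open Scope classical_set_scope.
Local Open Scope ring_scope.

Definition borelType (S : ptopologicalType) := g_sigma_algebraType (@open S).

(* S^n is represented by n.-tuple (borelType S), which mathcomp-analysis
   equips with the product sigma-algebra (generated by the coordinate maps). *)

Definition law {d d'} {Omega : measurableType d} {T : measurableType d'}
  {R : realType} (P : probability Omega R) (X : Omega -> T) : set T -> \bar R :=
  fun A => P (X @^-1` A).

Definition tperm {T : Type} {n : nat} (s : 'S_n) (t : n.-tuple T) : n.-tuple T :=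
  [tuple tnth t (s i) | i < n].

Definition exchangeable_law {d} {T : measurableType d} {R : realType} {n : nat}
  (mu : set (n.-tuple T) -> \bar R) :=
  forall (s : 'S_n) (A : set (n.-tuple T)), measurable A ->
    mu (tperm s @^-1` A) = mu A.

Definition first_coords {T : Type} {n N : nat} (hnN : (n <= N)%N)
  (y : N.-tuple T) : n.-tuple T :=
  [tuple tnth y (widen_ord hnN i) | i < n].

Definition extendible {d d'} {Omega : measurableType d} {T : measurableType d'}
  {R : realType} (P : probability Omega R) {n : nat} (X : Omega -> n.-tuple T)
  (N : nat) (hnN : (n <= N)%N) :=
  exists (d2 : measure_display) (Omega' : measurableType d2)
         (Q : probability Omega' R) (Y : Omega' -> N.-tuple T),
    [/\ measurable_fun setT Y,
        exchangeable_law (law Q Y) &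
        forall A : set (n.-tuple T), measurable A ->
          law Q (fun w => first_coords hnN (Y w)) A = law P X A].

Definition compose_tuple {T : Type} {n N : nat} (x : N.-tuple T)
  (f : {ffun 'I_n -> 'I_N}) : n.-tuple T :=
  [tuple tnth x (f i) | i < n].

Definition Ustat {T : Type} {R : realType} (n N : nat) (g : n.-tuple T -> R)
  (x : N.-tuple T) : R :=
  (\sum_(f : {ffun 'I_n -> 'I_N} | injectiveb f) g (compose_tuple x f))
    / ((N ^_ n)%N)%:R.

Definition ext_norm {d d'} {Omega : measurableType d} {T : measurableType d'}
  {R : realType} (P : probability Omega R) {n : nat} (X : Omega -> n.-tuple T)
  (N : nat) : \bar R :=
  ereal_sup [set `| (\int[P]_w (g (X w))%:E) |%E | g in
    [set g : n.-tuple T -> R |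
      [/\ measurable_fun setT g,
          (exists M : R, forall t, `|g t| <= M) &
          forall x : N.-tuple T, `|Ustat g x| <= 1]]].

Definition outer_regular {S : ptopologicalType} {R : realType}
  (mu : set (borelType S) -> \bar R) :=
  forall A : set (borelType S), measurable A ->
    mu A = ereal_inf [set mu O | O in [set O : set S | open O /\ A `<=` O]].

Definition tight {S : ptopologicalType} {R : realType}
  (mu : set (borelType S) -> \bar R) :=
  forall eps : R, 0 < eps ->
    exists K : set S, compact K /\ ((1 - eps)%:E <= mu K)%E.

(* Main.v *)
(* If X extends to an exchangeable Y, then averaging over the N! permutations
   gives E g(X) = E (U g)(Y), whence the norm is at most 1, and g = 1 attains it.

   Conversely, if the norm is 1 then U g |-> E g(X) is a well-defined linear
   functional bounded by the supremum of U g. By Hahn-Banach it extends to a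
   positive functional L on all bounded functions on S^N, and
   m A = L(symmetrization of 1_A) is a symmetric finitely additive probability on
   all subsets of S^N whose n-dimensional marginals are the law of X. The sets
   that m approximates from inside by compact sets and from outside by open sets
   form an algebra; it contains the cylinders because the law of X_1 is outer
   regular and tight. On this algebra compactness makes m countably
   subadditive, so m extends to a measure by Caratheodory's theorem. *)
Require Import Defs.
From HB Require Import structures.
From mathcomp Require Import all_boot all_order all_fingroup all_algebra.
From mathcomp Require Import all_classical all_reals all_analysis.
From mathcomp Require Import measurable_realfun finmap ring lra.
Import Order.TTheory GRing.Theory Num.Theory.
Local Open Scope classical_set_scope.
Local Open Scope ring_scope.

Set Implicit Arguments.
Unset Strict Implicit.

(** * Hahn-Banach extension under a sublinear bound *)

Section hahn_banach.
Context {R : realType} {V : lmodType R}.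
Variables (D : set V) (p : V -> R).
Hypothesis D_lin : forall a u v, D u -> D v -> D (a *: u + v).
Hypothesis pD : forall u v, D u -> D v -> p (u + v) <= p u + p v.
Hypothesis pZ : forall a u, 0 <= a -> D u -> p (a *: u) = a * p u.

(* Partial functionals are handled through their graphs; domination by [p]
   forces such a graph to be single-valued, see [dominated_graph_fun]. *)
Definition dominated_graph (G : set (V * R)) :=
  (forall a x y, G x -> G y -> G (a *: x.1 + y.1, a * x.2 + y.2)) /\
  (forall x, G x -> D x.1 /\ x.2 <= p x.1).

Lemma dominated_graph0 G v r : dominated_graph G -> G (v, r) -> G (0, 0).
Proof.
move=> [Glin _] Gv; have := Glin (-1) _ _ Gv Gv.
by rewrite /= scaleN1r addNr mulN1r addNr.
Qed.

Lemma dominated_graphZ G a v r : dominated_graph G -> G (v, r) ->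
  G (a *: v, a * r).
Proof.
move=> dG Gv; have := dG.1 a _ _ Gv (dominated_graph0 dG Gv).
by rewrite /= !addr0.
Qed.

Lemma dominated_graph_fun G v r r' : dominated_graph G ->
  G (v, r) -> G (v, r') -> r = r'.
Proof.
suff H : forall s s', dominated_graph G -> G (v, s) -> G (v, s') -> s' <= s.
  by move=> dG Gr Gr'; apply/eqP; rewrite eq_le !H.
move=> s s' dG Gs Gs'; have := dG.1 (-1) _ _ Gs Gs'.
rewrite /= scaleN1r addNr mulN1r => /dG.2[/= D0].
have -> : p 0 = 0 by rewrite -(scale0r 0) pZ// mul0r.
by rewrite addrC subr_le0.
Qed.

(** One-dimensional extension step: a value [c] at [v0] is admissible once it lies above every
    [r - p (w - v0)] and below every [p (w' + v0) - r']. Subadditivity of [p] separates the two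
    families, so the supremum of the first one serves as [c]. *)
Lemma dominated_graph_extend G v0 : dominated_graph G -> G !=set0 -> D v0 ->
  exists c, dominated_graph [set x | exists a w r,
    G (w, r) /\ x = (w + a *: v0, r + a * c)].
Proof.
move=> dG [[w0 r0] Gw0] Dv0.
have D0 : D 0 by have [] := dG.2 _ (dominated_graph0 dG Gw0).
have DZ a u : D u -> D (a *: u) by move=> Du; rewrite -[_ *: _]addr0; exact: D_lin.
have DD u v : D u -> D v -> D (u + v).
  by move=> Du Dv; rewrite -[u]scale1r; exact: D_lin.
have DB u v : D u -> D v -> D (u - v).
  by move=> Du Dv; apply: DD => //; rewrite -scaleN1r; exact: DZ.
have GD w r : G (w, r) -> D w by move=> /dG.2[].
have gap w r w' r' : G (w, r) -> G (w', r') -> r - p (w - v0) <= p (w' + v0) - r'.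
  move=> Gw Gw'; have /= [_ le1] := dG.2 _ (dG.1 1 _ _ Gw Gw').
  rewrite scale1r mul1r in le1.
  have : p (w - v0 + (w' + v0)) <= p (w - v0) + p (w' + v0).
    by apply: pD; [apply: DB => //; exact: GD Gw|apply: DD => //; exact: GD Gw'].
  rewrite addrACA [- v0 + v0]addNr addr0; lra.
pose E := [set x.2 - p (x.1 - v0) | x in G].
have supE : has_sup E.
  split; first by exists (r0 - p (w0 - v0)), (w0, r0).
  by exists (p (w0 + v0) - r0) => _ [[w r] Gw <-]; exact: gap.
exists (sup E); split.
  move=> a _ _ [b [w [r [Gw ->]]]] [b' [w' [r' [Gw' ->]]]] /=.
  exists (a * b + b'), (a *: w + w'), (a * r + r'); split.
    exact: (dG.1 a _ _ Gw Gw').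
  congr (_, _); last by ring.
  by rewrite scalerDr scalerDl scalerA addrACA.
move=> _ [a [w [r [Gw ->]]]] /=; split; first by apply: DD; [exact: GD Gw|exact: DZ].
(* Dividing by [|a|] reduces a nonzero [a] to the coefficient 1 or -1 of [v0]. For [a > 0] the
   choice of [c] below all upper bounds is used, for [a < 0] its choice above all elements of
   [E]. *)
have [a0|a0|->] := ltgtP a 0; last first.
- by rewrite scale0r mul0r !addr0; have [] := dG.2 _ Gw.
- have : sup E <= p (a^-1 *: w + v0) - a^-1 * r.
    apply: ge_sup => [|_ [[w' r'] Gw' <-]]; first by case: supE.
    by apply: gap => //; exact: dominated_graphZ.
  have -> : w + a *: v0 = a *: (a^-1 *: w + v0).
    by rewrite scalerDr scalerA divff ?scale1r// gt_eqF.
  rewrite pZ ?(ltW a0)//; last by apply: DD => //; apply: DZ; exact: GD Gw.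
  move=> H; have := ler_wpM2l (ltW a0) H.
  by rewrite mulrBr mulrA divff ?gt_eqF// mul1r; lra.
- pose b := - a; have b0 : 0 < b by rewrite oppr_gt0.
  have : b^-1 * r - p (b^-1 *: w - v0) <= sup E.
    apply: ub_le_sup; first by case: supE.
    by exists (b^-1 *: w, b^-1 * r) => //; exact: dominated_graphZ.
  have -> : w + a *: v0 = b *: (b^-1 *: w - v0).
    rewrite scalerBr scalerA divff ?scale1r ?gt_eqF//.
    by rewrite /b scaleNr opprK.
  rewrite pZ ?(ltW b0)//; last by apply: DB => //; apply: DZ; exact: GD Gw.
  move=> H; have := ler_wpM2l (ltW b0) H.
  by rewrite mulrBr mulrA divff ?gt_eqF// mul1r /b; lra.
Qed.

Lemma hahn_banach (G0 : set (V * R)) : dominated_graph G0 -> G0 !=set0 ->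
  exists L : V -> R,
    [/\ forall a u v, D u -> D v -> L (a *: u + v) = a * L u + L v,
        forall u, D u -> L u <= p u &
        forall v r, G0 (v, r) -> L v = r].
Proof.
move=> dG0 [x0 G0x0].
(* [G0] is joined to the members of the chain because [Zorn_bigcup] also
   requires the property for the union of the empty chain. *)
have [H [dH Hmax]] : exists H, dominated_graph (G0 `|` H) /\
    forall B, H `<` B -> ~ dominated_graph (G0 `|` B).
  apply: (@Zorn_bigcup _ (fun H => dominated_graph (G0 `|` H))) => F FP Ftot.
  (* Since [F] is a chain, any two points of the union already lie in one dominated graph, where
     linearity and domination can be checked. *)
  have common x y : (G0 `|` \bigcup_(X in F) X) x ->
      (G0 `|` \bigcup_(X in F) X) y ->
      exists2 Z, dominated_graph (G0 `|` Z) /\ Z `<=` \bigcup_(X in F) X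
        & (G0 `|` Z) x /\ (G0 `|` Z) y.
    move=> [Gx|[X FX Xx]] [Gy|[Y FY Yy]].
    - by exists set0; [rewrite setU0; split|split; left].
    - by exists Y; [split; [exact: FP|exact: bigcup_sup]|split; [left|right]].
    - by exists X; [split; [exact: FP|exact: bigcup_sup]|split; [right|left]].
    - have [XY|YX] := Ftot _ _ FX FY.
        exists Y; first by split; [exact: FP|exact: bigcup_sup].
        by split; right => //; exact: XY.
      exists X; first by split; [exact: FP|exact: bigcup_sup].
      by split; right => //; exact: YX.
  split=> [a x y /common/[apply] [[Z [dZ ZF] [Zx Zy]]]|x Gx].
    by have [|/ZF] := dZ.1 a _ _ Zx Zy; [left|right].
  by have [Z [dZ _] [Zx _]] := common _ _ Gx Gx; exact: dZ.2.
set G := G0 `|` H in dH.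
have G0G : G0 `<=` G by left.
(* Were [v] outside the domain of [G], the one-step extension [G'] would contradict maximality; it
   contains [(v, c)], obtained from the pair [(0, 0)] with coefficient 1. *)
have Gtot v : D v -> exists r, G (v, r).
  move=> Dv; have Gn0 : G !=set0 by exists x0; left.
  have [c dG'] := dominated_graph_extend dH Gn0 Dv.
  set G' := [set x | _] in dG'.
  have GG' : G `<=` G'.
    by move=> [w r] Gw; exists 0, w, r; rewrite scale0r mul0r !addr0.
  have G'v : G' (v, c).
    exists 1, 0, 0; split; last by rewrite scale1r mul1r !add0r.
    by case: x0 G0x0 {Gn0} => w r G0w; apply: (@dominated_graph0 _ w r) => //; left.
  apply: contrapT => nGv; apply: (Hmax G').
    split; first by move=> x Hx; apply: GG'; right.
    by move=> G'H; apply: nGv; exists c; right; exact: G'H.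
  by rewrite (_ : G0 `|` G' = G')//; apply/setUidPr => x G0x; apply: GG'; left.
exists (fun v => xget 0 [set r | G (v, r)]).
have LG v : D v -> G (v, xget 0 [set r | G (v, r)]).
  move=> Dv; have [r Gr] := Gtot _ Dv.
  exact: (xgetPex 0 (ex_intro [set r | G (v, r)] r Gr)).
split=> [a u v Du Dv|u Du|v r G0v].
- apply: (dominated_graph_fun dH (LG _ (D_lin a Du Dv))).
  exact: (dH.1 a _ _ (LG _ Du) (LG _ Dv)).
- by have [] := dH.2 _ (LG _ Du).
- have Gv := G0G _ G0v; have Dv := (dH.2 _ Gv).1.
  exact: (dominated_graph_fun dH (LG _ Dv)).
Qed.

End hahn_banach.

Definition bounded_real {R : realType} {T : Type} (f : T -> R) :=
  exists M : R, forall t, `|f t| <= M.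

Lemma bounded_real_lin {R : realType} {T : Type} (a : R) (f g : T -> R) :
  bounded_real f -> bounded_real g -> bounded_real (fun t => a * f t + g t).
Proof.
move=> [M fM] [M' gM']; exists (`|a| * M + M') => t.
by rewrite (le_trans (ler_normD _ _))// lerD// normrM ler_wpM2l.
Qed.

(** Hahn-Banach on the bounded functions with the supremum as sublinear bound. Positivity of [L] is
    automatic from this choice: for [f >= 0], [- L f = L (- f) <= sup (- f) <= 0]. *)
Lemma positive_extension {R : realType} {T : pointedType}
    (G0 : set ((T -> R^o) * R)) :
  (forall a x y, G0 x -> G0 y -> G0 (a *: x.1 + y.1, a * x.2 + y.2)) ->
  G0 (cst 1, 1) ->
  (forall x, G0 x -> bounded_real x.1 /\
    forall M, (forall t, x.1 t <= M) -> x.2 <= M) ->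
  exists L : (T -> R) -> R,
    [/\ forall a f g, bounded_real f -> bounded_real g ->
          L (fun t => a * f t + g t) = a * L f + L g,
        forall f, bounded_real f -> (forall t, 0 <= f t) -> 0 <= L f &
        forall f r, G0 (f, r) -> L f = r].
Proof.
move=> G0lin G01 G0sup.
have supB (f : T -> R) : bounded_real f -> has_sup (range f).
  move=> [M fM]; split; first by exists (f point), point.
  by exists M => _ [t _ <-]; exact: le_trans (ler_norm _) (fM t).
have le_supf (f : T -> R) t : bounded_real f -> f t <= sup (range f).
  by move=> /supB[_ ?]; apply: ub_le_sup => //; exists t.
have supf_le (f : T -> R) M : (forall t, f t <= M) -> sup (range f) <= M.
  move=> fM; apply: ge_sup; first by exists (f point), point.
  by move=> _ [t _ <-].
have [|u v bu bv|a u a0 bu|||L [Llin Ldom LG0]] := @hahn_banach R (T -> R^o)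
    bounded_real (fun f => sup (range (f : T -> R))) _ _ _ G0.
- by move=> a u v; exact: bounded_real_lin.
- by apply: supf_le => t; apply: lerD; exact: le_supf.
- have [->|an0] := eqVneq a 0.
    rewrite scale0r mul0r; apply/eqP; rewrite eq_le; apply/andP; split.
      exact: supf_le.
    by apply: (@le_supf _ point); exists 0 => t; rewrite normr0.
  have {an0}a0 : 0 < a by rewrite lt_neqAle eq_sym an0.
  have bau : bounded_real (a *: u : T -> R).
    by move: bu => [M uM]; exists (a * M) => t; rewrite normrM gtr0_norm// ler_pM2l.
  apply/eqP; rewrite eq_le; apply/andP; split.
    by apply: supf_le => t; rewrite ler_pM2l// le_supf.
  rewrite mulrC -ler_pdivlMr//; apply: supf_le => t.
  by rewrite ler_pdivlMr// mulrC; exact: (le_supf _ _ bau).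
- split=> // x Gx; have [bx xM] := G0sup _ Gx; split => //.
  by apply: xM => t; exact: le_supf.
- by exists (cst 1, 1).
have b0 : bounded_real (fun _ : T => 0 : R) by exists 0 => t; rewrite normr0.
have L0 : L (fun=> 0) = 0.
  by have := Llin (-1) 0 0 b0 b0; rewrite scaler0 addr0 mulN1r addNr.
exists L; split=> // f bf f0.
have := Llin (-1) f 0 bf b0; rewrite L0 !addr0 mulN1r => Lf.
have bNf : bounded_real (-1 *: (f : T -> R^o)).
  by move: bf => [M fM]; exists M => t; rewrite normrM normrN1 mul1r.
rewrite -oppr_le0 -Lf; apply: (le_trans (Ldom _ bNf)).
apply: supf_le => t.
by rewrite (mulN1r (f t) : (-1 *: (f : T -> R^o)) t = _) oppr_le0.
Qed.

(** * Finitely additive probabilities on all subsets *)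

Section finitely_additive.
Context {R : realType} {T : Type} (m : set T -> R).

Definition finitely_additive_probability :=
  [/\ m setT = 1, (forall A, 0 <= m A) &
      forall A B, A `&` B = set0 -> m (A `|` B) = m A + m B].

Hypothesis hm : finitely_additive_probability.

Let m_ge0 A : 0 <= m A. Proof. by case: hm. Qed.
Let mU A B : A `&` B = set0 -> m (A `|` B) = m A + m B.
Proof. by case: hm => _ _; exact. Qed.

Lemma fap0 : m set0 = 0.
Proof. by have := mU (setI0 set0); rewrite setU0; lra. Qed.

Lemma fapD A B : A `<=` B -> m B = m A + m (B `\` A).
Proof.
move=> AB; rewrite -mU; first by rewrite setDUK.
by rewrite setDE setIC -setIA setICl setI0.
Qed.

Lemma le_fap A B : A `<=` B -> m A <= m B.
Proof. by move=> /fapD ->; rewrite lerDl. Qed.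

Lemma fapU_le A B : m (A `|` B) <= m A + m B.
Proof.
rewrite (@fapD A); last exact: subsetUl.
by rewrite lerD2l le_fap// setDUl setDv set0U; exact: subDsetl.
Qed.

Lemma fap_bigU_le (I : Type) (s : seq I) (F : I -> set T) :
  m (\big[setU/set0]_(i <- s) F i) <= \sum_(i <- s) m (F i).
Proof.
elim: s => [|i s IH]; first by rewrite !big_nil fap0.
by rewrite !big_cons (le_trans (fapU_le _ _))// lerD2l.
Qed.

Lemma fapC A : m (~` A) = 1 - m A.
Proof.
have [m1 _ _] := hm; rewrite -m1 (@fapD A setT)// setTD; lra.
Qed.

End finitely_additive.

(** * Caratheodory extension from an algebra of sets *)

Section algebra_of_sets.
Context {T : pointedType} (A : set (set T)).
Hypotheses (A0 : A set0) (AU : setU_closed A) (AC : setC_closed A).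

(* The closure properties are arguments of the type so that the algebra
   structure can be inferred from it. *)
Definition algebra_type : Type := let _ := (A0, AU, AC) in T.

HB.instance Definition _ := Pointed.copy algebra_type T.

HB.instance Definition _ := isAlgebraOfSets.Build default_measure_display
  algebra_type A0 AU AC.

End algebra_of_sets.

(** Normalizing a measure of mass 1 does not change it. The Dirac measure is only the fallback of
    [mnormalize] for mass 0 or infinity, a case excluded here. *)
Lemma probability_of_measure d (T : measurableType d) (R : realType)
  (mu : {measure set T -> \bar R}) : mu setT = 1%E ->
  exists Q : probability T R, forall B, Q B = mu B.
Proof.
move=> mu1; exists (mnormalize mu (dirac point : probability T R)) => B.
by rewrite /= /mnormalize mu1/= onee_eq0/= invr1 mule1.
Qed.

Section caratheodory.
Context {R : realType} {T : pointedType} (m : set T -> R) (A : set (set T)).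
Hypotheses (hm : finitely_additive_probability m) (A0 : A set0)
  (AU : setU_closed A) (AC : setC_closed A).
Hypothesis m_sigma : forall (B : set T) (F : nat -> set T),
  (forall k, A (F k)) -> A B -> B `<=` \bigcup_k F k ->
  ((m B)%:E <= \sum_(k <oo) (m (F k))%:E)%E.

(** The sample space is [T] itself with the sigma-algebra generated by [A], and [h] is the identity;
    the existential form hides this second structure on [T]. *)
Lemma caratheodory_probability :
  exists d (Omega : measurableType d) (Q : probability Omega R) (h : Omega -> T),
    forall B, A B -> measurable (h @^-1` B) /\ Q (h @^-1` B) = (m B)%:E.
Proof.
pose AT := algebra_type A0 AU AC : algebraOfSetsType default_measure_display.
pose mu0 : set AT -> \bar R := fun B => (m B)%:E.
have mu0_ge0 B : (0 <= mu0 B)%E by rewrite lee_fin; case: hm.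
have mu0_add : measure_function.semi_additive mu0.
  apply/additive2P; first by rewrite /mu0 (fap0 hm).
  move=> B C _ _ BC; rewrite /mu0 -EFinD; congr EFin.
  by case: hm => _ _; exact.
pose c_mu := isContent.Build _ AT R mu0 mu0_ge0 mu0_add.
pose mu1 : {content set AT -> \bar R} := HB.pack mu0 c_mu.
have mu1_sub : measurable_subset_sigma_subadditive mu1.
  by move=> B F AF AB BF; exact: m_sigma.
pose mu : {measure set AT -> \bar R} := HB.pack mu0 c_mu
  (Content_SigmaSubAdditive_isMeasure.Build _ R AT mu1 mu1_sub).
have QE B : A B -> measure_extension mu B = (m B)%:E.
  by move=> AB; rewrite /measure_extension measurable_mu_extE.
have QT : measure_extension mu setT = 1%E.
  by rewrite QE; [case: hm => ->|rewrite -setC0; exact: AC].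
have [Q QE'] := probability_of_measure QT.
exists _, _, Q, id => B AB; split; first exact: sub_sigma_algebra.
by rewrite QE'; exact: QE.
Qed.

End caratheodory.

(** * Sets approximable by compact and open sets *)

Section regular_sets.
Context {R : realType} {T : ptopologicalType} (m : set T -> R).
Hypothesis hm : finitely_additive_probability m.

(* [m] is defined on all subsets, so [V `\` K] need not be measurable. *)
Definition regular_set (A : set T) := forall e : R, 0 < e ->
  exists K V, [/\ compact K, closed K & open V] /\
    [/\ K `<=` A, A `<=` V & m (V `\` K) <= e].

Definition finitely_tight := forall e : R, 0 < e ->
  exists K, [/\ compact K, closed K & m (~` K) <= e].

Lemma regular_set0 : regular_set set0.
Proof.
move=> e e0; exists set0, set0; split.
  by split; [exact: compact0|exact: closed0|exact: open0].
by split=> //; rewrite setD0 (fap0 hm) ltW.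
Qed.

Lemma regular_setU : setU_closed regular_set.
Proof.
move=> A B rA rB e e0; have e20 : 0 < e / 2 by lra.
have [K1 [U1 [[cK1 clK1 oO1] [KA AV me1]]]] := rA _ e20.
have [K2 [U2 [[cK2 clK2 oO2] [KB BV me2]]]] := rB _ e20.
exists (K1 `|` K2), (U1 `|` U2); split.
  by split; [exact: compactU|exact: closedU|exact: openU].
split; [exact: setUSS|exact: setUSS|].
apply: (@le_trans _ _ (m ((U1 `\` K1) `|` (U2 `\` K2)))).
  apply: (le_fap hm) => x [[Ox|Ox] /not_orP[nK1 nK2]]; first by left.
  by right.
by apply: (le_trans (fapU_le hm _ _)); lra.
Qed.

Hypothesis tm : finitely_tight.

(** Complementation exchanges the inner and outer approximations. The complement of [K] is open
    because [K] is closed; the complement of [V] is merely closed, so it is cut by a compact [K0]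
    carrying all mass but [e / 2]. *)
Lemma regular_setC : setC_closed regular_set.
Proof.
move=> A rA e e0; have e20 : 0 < e / 2 by lra.
have [K [V [[cK clK oV] [KA AV me]]]] := rA _ e20.
have [K0 [cK0 clK0 me0]] := tm e20.
exists (K0 `&` ~` V), (~` K); split.
  split; last by rewrite openC.
  - by apply: compact_closedI => //; rewrite closedC.
  - by apply: closedI => //; rewrite closedC.
split; [by move=> x [_ nV] Ax; exact: nV (AV _ Ax)|exact: subsetC|].
apply: (@le_trans _ _ (m (~` K0 `|` (V `\` K)))).
  apply: (le_fap hm) => x [nKx /not_andP[nK0|/contrapT Vx]]; first by left.
  by right.
by apply: (le_trans (fapU_le hm _ _)); lra.
Qed.

(* [K] compact inside [B] is covered by finitely many of the open hulls of
   the [F k], so that finite subadditivity of [m] suffices. *)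
Lemma regular_set_sigma_subadditive (B : set T) (F : nat -> set T) :
  (forall k, regular_set (F k)) -> regular_set B -> B `<=` \bigcup_k F k ->
  ((m B)%:E <= \sum_(k <oo) (m (F k))%:E)%E.
Proof.
have m_ge0 A : 0 <= m A by case: hm.
move=> rF rB BF; apply/lee_addgt0Pr => e e0.
have e20 : 0 < e / 2 by lra.
have [K [V [[cK _ oV] [KB BV mVK]]]] := rB _ e20.
(* These errors for the hulls of the [F k] sum to [e / 2]; the other half of [e] pays for replacing
   [B] by [K]. *)
have ek0 k : 0 < e / 2 / (2 ^ k.+1)%:R by rewrite divr_gt0// ltr0n expn_gt0.
have /choice[U FU] k : exists U, [/\ open U, F k `<=` U &
    m U <= m (F k) + e / 2 / (2 ^ k.+1)%:R].
  have [K' [U [[_ _ oU] [K'F FU mUK]]]] := rF k _ (ek0 k).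
  exists U; split=> //; rewrite (fapD hm (subset_trans K'F FU)).
  by rewrite lerD// le_fap.
have KU : K `<=` \bigcup_k U k.
  move=> x /KB /BF[k _ Fx]; exists k => //; by have [_ + _] := FU k; exact.
move: cK; rewrite compact_cover => /(_ _ setT U) [k _|//|D _ KD].
  by have [] := FU k.
have [n Dn] : exists n, forall k, k \in D -> (k < n)%N.
  exists (\max_(k <- enum_fset D) k).+1 => k kD; rewrite ltnS.
  exact: (@leq_bigmax_seq _ _ (fun=> true) (fun k => k)).
have mK : m K <= \sum_(k < n) (m (F k) + e / 2 / (2 ^ k.+1)%:R).
  apply: (@le_trans _ _ (m (\big[setU/set0]_(k < n) U k))).
    apply: (le_fap hm) => x /KD[k /= kD Ux].
    by rewrite -bigcup_mkord; exists k => //=; exact: Dn.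
  apply: (le_trans (fap_bigU_le hm _ _)); apply: ler_sum => k _.
  by have [] := FU k.
have mB : m B <= m K + e / 2.
  apply: (@le_trans _ _ (m K + m (B `\` K))); first by rewrite (fapD hm KB).
  by rewrite lerD2l (le_trans _ mVK)// (le_fap hm)//; exact: setSD.
apply: (@le_trans _ _ ((\sum_(k < n) (m (F k) + e / 2 / (2 ^ k.+1)%:R))%:E
    + (e / 2)%:E)%E).
  by rewrite -EFinD lee_fin; lra.
rewrite [in leRHS](splitr e) EFinD addeA leeD2r//.
apply: (le_trans _ (epsilon_trick _ _ (ltW e20))) => [|k]; last first.
  by rewrite lee_fin.
rewrite -sumEFin -(big_mkord xpredT (fun k => (m (F k) + e / 2 / (2 ^ k.+1)%:R)%:E)).
by apply: nneseries_lim_ge => k _ _; rewrite lee_fin addr_ge0// ltW.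
Qed.

Lemma regular_set_probability :
  exists d (Omega : measurableType d) (Q : probability Omega R) (h : Omega -> T),
    forall B, regular_set B ->
      measurable (h @^-1` B) /\ Q (h @^-1` B) = (m B)%:E.
Proof.
apply: caratheodory_probability => //.
- exact: regular_set0.
- exact: regular_setU.
- exact: regular_setC.
- exact: regular_set_sigma_subadditive.
Qed.

End regular_sets.

(** Makes the product space a [ptopologicalType], so that the results on regular sets apply to
    it. *)
HB.instance Definition _ (I : Type) (T : I -> ptopologicalType) :=
  Pointed.copy (prod_topology T) (forall i, T i).

(** * Tightness and regularity of cylinders in the product space *)

Section cylinders.
Context {R : realType} {S : ptopologicalType} {N : nat}.
Hypothesis hS : hausdorff_space S.

Notation T := (prod_topology (fun _ : 'I_N => S)).

Variables (m : set T -> R) (mu : set (borelType S) -> \bar R).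
Hypotheses (hm : finitely_additive_probability m)
  (mu_or : outer_regular mu) (mu_tight : tight mu)
  (mu_m : forall i A, measurable A -> mu A = (m [set f | A (f i)])%:E).

Lemma open_measurable_borelType (V : set S) :
  open V -> measurable (V : set (borelType S)).
Proof. exact: sub_sigma_algebra. Qed.

Lemma closed_measurable_borelType (K : set S) :
  closed K -> measurable (K : set (borelType S)).
Proof.
move=> clK; rewrite -[K]setCK; apply: measurableC.
by apply: open_measurable_borelType; exact: closed_openC.
Qed.

Lemma open_cylinder i (V : set S) : open V -> open [set f : T | V (f i)].
Proof.
move=> oV; apply: (@open_comp T S (fun f => f i) V) => // f _.
exact: (@proj_continuous _ (fun _ : 'I_N => S) i f).
Qed.

Lemma closed_cylinder i (K : set S) : closed K -> closed [set f : T | K (f i)].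
Proof.
move=> clK; rewrite -openC.
by apply: (@open_cylinder i (~` K)); exact: closed_openC.
Qed.

(** By Tychonoff the power [K0] of a compact [K] is compact, and its complement is covered by [N]
    cylinders over the complement of [K], each of small mass since all marginals equal [mu]. *)
Lemma cylinders_tight : finitely_tight m.
Proof.
(* Dividing by [N.+1] instead of [N] keeps the denominator nonzero when [N = 0]. *)
move=> e e0; have N0 : 0 < N.+1%:R :> R by rewrite ltr0n.
have eN0 : 0 < e / N.+1%:R by rewrite divr_gt0.
have [K [cK muK]] := mu_tight eN0.
have clK : closed K := compact_closed hS cK.
pose K0 : set T := [set f | forall i, K (f i)].
have cK0 : compact K0 by exact: (@tychonoff _ (fun _ => S) (fun _ => K)).
exists K0; split=> //.
  apply: compact_closed => //; exact: (@hausdorff_product _ (fun _ => S)).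
apply: (@le_trans _ _ (m (\big[setU/set0]_(i < N) (~` [set f | K (f i)])))).
  apply: (le_fap hm) => f /existsNP[i nKi].
  by rewrite -bigcup_seq; exists i => //=; rewrite mem_index_enum.
apply: (le_trans (fap_bigU_le hm _ _)).
apply: (@le_trans _ _ (\sum_(i < N) (e / N.+1%:R))).
  apply: ler_sum => i _; rewrite (fapC hm).
  move: muK; rewrite (mu_m i) ?lee_fin; last exact: closed_measurable_borelType.
  by rewrite lerBlDr -lerBlDl.
rewrite sumr_const card_ord -[leLHS]mulr_natr -mulrA -[leRHS]mulr1 ler_pM2l//.
by rewrite mulrC ler_pdivrMr// mul1r ler_nat.
Qed.

Lemma open_hull i (A : set (borelType S)) (e : R) : measurable A -> 0 < e ->
  exists V : set S, [/\ open V, A `<=` V &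
    m [set f | (V `\` A) (f i)] <= e].
Proof.
move=> mA e0; have mu_fin : mu A \is a fin_num by rewrite (mu_m i).
have : (ereal_inf [set mu V | V in [set V : set S | open V /\ A `<=` V]]
    \is a fin_num)%E by rewrite -mu_or.
move=> /(lb_ereal_inf_adherent e0)[_ [V [oV AV] <-]].
rewrite -(mu_or mA) !(mu_m i)//; last exact: open_measurable_borelType.
rewrite -EFinD lte_fin => Ve; exists V; split=> //.
have := fapD hm (_ : [set f : T | A (f i)] `<=` [set f | V (f i)]).
move=> /(_ (fun f => AV (f i))) mV.
rewrite (_ : [set f | _] = [set f : T | V (f i)] `\` [set f | A (f i)])//; lra.
Qed.

(** Outer regularity applied to the complement of [A] gives inner approximation by closed sets: the
    complement of its open hull [W] is a closed subset of [A]. Intersecting with the compact set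
    from tightness makes it compact. *)
Lemma regular_cylinder i (A : set (borelType S)) :
  measurable A -> regular_set m [set f | A (f i)].
Proof.
move=> mA e e0; have e30 : 0 < e / 3 by lra.
have [V [oV AV mV]] := open_hull i mA e30.
have [W [oW AW mW]] := open_hull i (measurableC mA) e30.
have [K [cK clK mK]] := cylinders_tight e30.
have clW : closed [set f : T | (~` W) (f i)].
  by apply: closed_cylinder; exact: open_closedC.
exists (K `&` [set f | (~` W) (f i)]), [set f | V (f i)]; split.
  split; [exact: compact_closedI|exact: closedI|exact: open_cylinder].
split; [|by move=> f; exact: AV|].
  by move=> f [_ nW]; apply: contrapT => nA; exact: nW (AW _ nA).
(* The gap between the two approximations splits into three errors of at most [e / 3]: loss of
   tightness, excess of [V] over [A], and excess of [W] over the complement of [A]. *)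
apply: (@le_trans _ _ (m (~` K `|` [set f | (V `\` A) (f i)] `|`
    [set f | (W `\` ~` A) (f i)]))).
  apply: (le_fap hm) => f [Vf /not_andP[nK|/contrapT Wf]]; first by left; left.
  have [Af|nA] := pselect (A (f i)); last by left; right.
  by right; split => // nA; exact: nA.
have := fapU_le hm (~` K `|` [set f | (V `\` A) (f i)])
  [set f | (W `\` ~` A) (f i)].
have := fapU_le hm (~` K) [set f | (V `\` A) (f i)].
lra.
Qed.

End cylinders.

(** * U-statistics as averages over permutations *)

Section symmetrization.
Context {R : realType} {T : Type} {n N : nat} (hnN : (n <= N)%N).

(** The values of [f] in order, followed by the indices that [f] misses, enumerate all [N] indices
    without repetition; the permutation reads off this list. *)
Lemma injection_extends_perm (f : {ffun 'I_n -> 'I_N}) : injectiveb f ->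
  exists s : 'S_N, forall i, s (widen_ord hnN i) = f i.
Proof.
move=> f_inj; have {}f_inj : uniq (codom f) by [].
pose t := codom f ++ [seq j <- enum 'I_N | j \notin codom f].
have t_uniq : uniq t.
  rewrite cat_uniq f_inj filter_uniq ?enum_uniq// andbT.
  by apply/hasPn => j; rewrite mem_filter => /andP[].
have t_size : size t = N.
  rewrite -[RHS]size_enum_ord; apply/perm_size/uniq_perm; rewrite ?enum_uniq//.
  move=> j; rewrite mem_cat mem_filter mem_enum andbT.
  by case: (j \in codom f).
have s_inj : injective (fun j : 'I_N => nth j t j).
  move=> i j; rewrite (set_nth_default i); last by rewrite t_size.
  by move/eqP; rewrite nth_uniq ?t_size// => /eqP/val_inj.
exists (perm s_inj) => i; rewrite permE /= nth_cat size_codom card_ord ltn_ord.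
have -> : nth (widen_ord hnN i) (codom f) i = nth (f i) (codom f) i.
  by apply: set_nth_default; rewrite size_codom card_ord.
by rewrite codomE (nth_map i) ?size_enum_ord// nth_ord_enum.
Qed.

(** Composition with [s] permutes the injections over which [Ustat] sums. *)
Lemma Ustat_tperm (g : n.-tuple T -> R) (s : 'S_N) x :
  Ustat g (Defs.tperm s x) = Ustat g x.
Proof.
rewrite /Ustat; congr (_ / _).
pose h (f : {ffun 'I_n -> 'I_N}) := [ffun i => s (f i)].
have h_inj : injective h.
  move=> f f' /ffunP hE; apply/ffunP => i.
  by have := hE i; rewrite !ffunE => /perm_inj.
rewrite [RHS](reindex_inj h_inj); apply: eq_big => [f|f _].
  apply/injectiveP/injectiveP => f_inj i j.
    by rewrite !ffunE => /perm_inj /f_inj.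
  by move=> fij; apply: f_inj; rewrite !ffunE fij.
by congr g; apply: eq_from_tnth => i; rewrite !tnth_mktuple ffunE.
Qed.

Lemma sum_perm_injection (g : n.-tuple T -> R) (f : {ffun 'I_n -> 'I_N}) x :
  injectiveb f -> \sum_(s : 'S_N) g (compose_tuple (Defs.tperm s x) f) =
    \sum_(s : 'S_N) g (first_coords hnN (Defs.tperm s x)).
Proof.
move=> /injection_extends_perm[s0 s0f].
(* With [s0] extending [f], the product [s0 * s] sends the first [n] indices to [s (f i)]. *)
rewrite [RHS](reindex_inj (mulgI s0)); apply: eq_bigr => s _.
by congr g; apply: eq_from_tnth => i; rewrite !tnth_mktuple permM s0f.
Qed.

(* Both sides are computed from the double sum over injections [f] and
   permutations [s] of [g] at [x o s o f], so that the fibres of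
   [s |-> s o widen_ord] need not be counted. *)
Lemma sum_perm_Ustat (g : n.-tuple T -> R) x :
  \sum_(s : 'S_N) g (first_coords hnN (Defs.tperm s x)) = N`!%:R * Ustat g x.
Proof.
have ffN0 : (N ^_ n)%:R != 0 :> R by rewrite pnatr_eq0 -lt0n ffact_gt0.
apply: (mulfI ffN0).
transitivity (\sum_(f : {ffun 'I_n -> 'I_N} | injectiveb f) \sum_(s : 'S_N)
    g (compose_tuple (Defs.tperm s x) f)).
  rewrite (eq_bigr _ (fun f => @sum_perm_injection g f x)).
  rewrite sumr_const -[RHS]mulr_natl; congr (_%:R * _).
  have := card_inj_ffuns 'I_n 'I_N; rewrite !card_ord => <-.
  by apply: eq_card => f; rewrite !inE.
rewrite exchange_big/=.
transitivity (\sum_(s : 'S_N) (N ^_ n)%:R * Ustat g (Defs.tperm s x)).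
  by apply: eq_bigr => s _; rewrite /Ustat mulrC divfK.
under eq_bigr do rewrite Ustat_tperm.
by rewrite sumr_const card_Sn -[LHS]mulr_natl; ring.
Qed.

Lemma Ustat_lin (a : R) (g h : n.-tuple T -> R) (x : N.-tuple T) :
  Ustat (fun t => a * g t + h t) x = a * Ustat g x + Ustat h x.
Proof. by rewrite /Ustat big_split/= -mulr_sumr mulrDl mulrA. Qed.

Lemma Ustat_norm_le (g : n.-tuple T -> R) (M : R) (x : N.-tuple T) :
  (forall t, `|g t| <= M) -> `|Ustat g x| <= M.
Proof.
move=> gM; have N0 : 0 < N`!%:R :> R by rewrite ltr0n fact_gt0.
rewrite -(ler_pM2l N0) -[X in X * `|_|](gtr0_norm N0) -normrM -sum_perm_Ustat.
apply: (le_trans (ler_norm_sum _ _ _)).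
apply: (@le_trans _ _ (\sum_(s : 'S_N) M)); first exact: ler_sum.
by rewrite sumr_const card_Sn -[leLHS]mulr_natl.
Qed.

Lemma Ustat_cst (c : R) (x : N.-tuple T) : Ustat (fun _ : n.-tuple T => c) x = c.
Proof.
have N0 : N`!%:R != 0 :> R by rewrite pnatr_eq0 -lt0n fact_gt0.
apply: (mulfI N0); rewrite -(@sum_perm_Ustat (fun=> c)).
by rewrite sumr_const card_Sn mulr_natl.
Qed.

End symmetrization.

(** * Integrals of bounded functions depend only on the law *)

Section expectations.
Context {R : realType}.

Lemma bounded_integrable {d} {Omega : measurableType d}
  (P : probability Omega R) (f : Omega -> R) :
  measurable_fun setT f -> bounded_real f -> P.-integrable setT (EFin \o f).
Proof.
move=> mf [M fM]; apply: measurable_bounded_integrable => //.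
  by rewrite (le_lt_trans (probability_le1 P measurableT))// ltry.
exists M; split; first exact: num_real.
by move=> y My t _; exact: le_trans (fM t) (ltW My).
Qed.

Lemma bounded_real_comp {T U : Type} (g : U -> R) (f : T -> U) :
  bounded_real g -> bounded_real (g \o f).
Proof. by move=> [M gM]; exists M => t; exact: gM. Qed.

Lemma eq_law_integral {d d1 d2} {T : measurableType d}
  {Omega1 : measurableType d1} {Omega2 : measurableType d2}
  (P1 : probability Omega1 R) (P2 : probability Omega2 R)
  (X1 : Omega1 -> T) (X2 : Omega2 -> T) (g : T -> R) :
  measurable_fun setT X1 -> measurable_fun setT X2 ->
  (forall A, measurable A -> law P1 X1 A = law P2 X2 A) ->
  measurable_fun setT g -> bounded_real g ->
  (\int[P1]_w (g (X1 w))%:E = \int[P2]_w (g (X2 w))%:E)%E.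
Proof.
move=> mX1 mX2 lawE mg bg.
have /measurable_EFinP mEg := mg.
have push d' (Omega : measurableType d') (P : probability Omega R) (X : Omega -> T) :
    measurable_fun setT X ->
    (\int[P]_w (g (X w))%:E = \int[pushforward P X]_y (g y)%:E)%E.
  move=> mX; rewrite (integral_pushforward mX mEg)//.
  apply: (@bounded_integrable _ _ P (g \o X)); first exact: measurableT_comp.
  exact: bounded_real_comp.
rewrite !push//; apply: eq_measure_integral => A mA _; exact: lawE.
Qed.

Lemma integral_le_bounded {d} {Omega : measurableType d}
  (P : probability Omega R) (f : Omega -> R) (M : R) :
  measurable_fun setT f -> (forall w, `|f w| <= M) ->
  (`| \int[P]_w (f w)%:E | <= M%:E)%E.
Proof.
move=> /measurable_EFinP mEf fM.
apply: (le_trans (le_abse_integral _ _ mEf)) => //.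
apply: (@le_trans _ _ (\int[P]_w (cst M%:E w))%E).
  apply: ge0_le_integral => //.
  - exact: measurableT_comp.
  - by move=> w _; rewrite lee_fin; exact: fM.
by rewrite integral_cst//= probability_setT mule1.
Qed.

End expectations.

(** * Measurability of tuple maps and uniqueness of laws on tuples *)

Section tuple_measurability.
Context {d} {T : measurableType d}.

Lemma measurable_mktuple_tnth {d'} {Omega : measurableType d'} (n N : nat)
  (Y : Omega -> N.-tuple T) (f : 'I_n -> 'I_N) : measurable_fun setT Y ->
  measurable_fun setT (fun w => [tuple tnth (Y w) (f i) | i < n]).
Proof.
move=> /measurable_fun_tnthP mY; apply/measurable_fun_tnthP => i.
apply: eq_measurable_fun (mY (f i)) => w _ /=.
by rewrite tnth_mktuple.
Qed.

Lemma measurable_tperm (N : nat) (s : 'S_N) :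
  measurable_fun setT (Defs.tperm s : N.-tuple T -> N.-tuple T).
Proof.
by apply: (@measurable_mktuple_tnth _ _ _ _ id) => //; exact: measurable_id.
Qed.

Lemma measurable_first_coords (n N : nat) (hnN : (n <= N)%N) :
  measurable_fun setT (first_coords hnN : N.-tuple T -> n.-tuple T).
Proof.
by apply: (@measurable_mktuple_tnth _ _ _ _ id) => //; exact: measurable_id.
Qed.

Lemma measurable_Ustat {R : realType} (n N : nat) (g : n.-tuple T -> R) :
  measurable_fun setT g ->
  measurable_fun setT (Ustat g : N.-tuple T -> R).
Proof.
move=> mg; apply: measurable_funM; last exact: measurable_cst.
under eq_fun do rewrite -big_filter.
apply: measurable_sum => f; apply: (measurableT_comp mg).
by apply: (@measurable_mktuple_tnth _ _ _ _ id) => //; exact: measurable_id.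
Qed.

Lemma measurable_coord (n : nat) (i : 'I_n) (A : set T) : measurable A ->
  measurable [set t : n.-tuple T | A (tnth t i)].
Proof. by move=> mA; have := measurable_tnth i measurableT mA; rewrite setTI. Qed.

(** Uniqueness of measures on a pi-system containing the coordinate cylinders, which generate the
    product sigma-algebra. [G] may contain non-measurable sets, as happens when it is defined by
    regularity, so the pi-system used is its measurable part. *)
Lemma eq_law_tuple {R : realType} {d1 d2} {Omega1 : measurableType d1}
  {Omega2 : measurableType d2} (P1 : probability Omega1 R)
  (P2 : probability Omega2 R) (n : nat) (X1 : Omega1 -> n.-tuple T)
  (X2 : Omega2 -> n.-tuple T) (G : set (set (n.-tuple T))) :
  measurable_fun setT X1 -> measurable_fun setT X2 ->
  setI_closed G -> G setT ->
  (forall i A, measurable A -> G [set t | A (tnth t i)]) ->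
  (forall A, measurable A -> G A -> law P1 X1 A = law P2 X2 A) ->
  forall A, measurable A -> law P1 X1 A = law P2 X2 A.
Proof.
move=> mX1 mX2 GI GT Gcyl P12.
have law_oo : (pushforward P1 X1 setT < +oo)%E.
  by rewrite (le_lt_trans (probability_le1 P1 measurableT))// ltry.
move=> A mA; change (pushforward P1 X1 A = pushforward P2 X2 A); move: A mA.
apply: (measure_unique (G `&` measurable) (fun=> setT)).
- apply/seteqP; split=> A.
    apply: smallest_sub; first exact: smallest_sigma_algebra.
    move=> B; rewrite -bigcup_seq => -[i /= _ [C mC <-]].
    apply: sub_sigma_algebra; rewrite setTI.
    by split; [exact: Gcyl|exact: measurable_coord].
  apply: smallest_sub; first exact: sigma_algebra_measurable.
  by move=> B [].
- by move=> A B [GA mA] [GB mB]; split; [exact: GI|exact: measurableI].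
- by move=> _; split.
- by rewrite bigcup_const//; exists 0%N.
- by move=> A [GA mA]; exact: P12.
- by move=> _; exact: law_oo.
Qed.

End tuple_measurability.

(** * Consequences of extendibility and of norm one *)

Section extendible_norm.
Context {R : realType} {d} {T : measurableType d} {n N : nat}
  (hnN : (n <= N)%N) {d'} {Omega : measurableType d'}
  (P : probability Omega R) (X : Omega -> n.-tuple T).
Hypothesis mX : measurable_fun setT X.

Lemma ext_norm_ge1 : (1 <= ext_norm P X N)%E.
Proof.
apply: ereal_sup_ubound; exists (fun=> 1).
  split; first exact: measurable_cst.
    by exists 1 => _; rewrite normr1.
  by move=> x; rewrite (Ustat_cst hnN) normr1.
by rewrite integral_cst//= probability_setT mule1 abse1.
Qed.

Lemma extendible_integral_le1 (g : n.-tuple T -> R) : extendible P X hnN ->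
  measurable_fun setT g -> bounded_real g ->
  (forall x : N.-tuple T, `|Ustat g x| <= 1) ->
  (`| \int[P]_w (g (X w))%:E | <= 1)%E.
Proof.
move=> [d2 [W [Q [Y [mY excY YX]]]]] mg bg gU.
have mfirst := @measurable_first_coords _ T n N hnN.
have mgf : measurable_fun setT (g \o first_coords hnN) := measurableT_comp mg mfirst.
have bgf : bounded_real (g \o first_coords hnN) := bounded_real_comp _ bg.
have int_fin : (\int[P]_w (g (X w))%:E)%E \is a fin_num.
  apply: integrable_fin_num => //; apply: (@bounded_integrable _ _ _ P (g \o X)).
    exact: measurableT_comp.
  exact: bounded_real_comp.
(* Exchangeability of [Y] makes each of the [N!] permuted integrals equal to the integral of
   [g (X w)]; their sum is the integral of [N! * Ustat g (Y w)], which is at most [N!] in absolute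
   value. *)
have int_perm (s : 'S_N) : (\int[P]_w (g (X w))%:E =
    \int[Q]_w (g (first_coords hnN (Defs.tperm s (Y w))))%:E)%E.
  transitivity (\int[Q]_w (g (first_coords hnN (Y w)))%:E)%E.
    apply: (@eq_law_integral _ _ _ _ _ _ _ P Q X (first_coords hnN \o Y)) => //.
      exact: measurableT_comp.
    by move=> A mA; rewrite YX.
  apply: (@eq_law_integral _ _ _ _ _ _ _ Q Q Y (Defs.tperm s \o Y)
    (g \o first_coords hnN)) => //.
    by apply: measurableT_comp => //; exact: measurable_tperm.
  by move=> A mA; rewrite -(excY s).
have N0 : 0 < N`!%:R :> R by rewrite ltr0n fact_gt0.
have : (`| \int[Q]_w (N`!%:R * Ustat g (Y w))%:E | <= (N`!%:R)%:E)%E.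
  apply: integral_le_bounded => [|w].
    apply: measurable_funM; first exact: measurable_cst.
    by apply: measurableT_comp => //; exact: measurable_Ustat.
  by rewrite normrM gtr0_norm// ler_piMr// ltW.
under eq_integral do rewrite -(sum_perm_Ustat hnN) -sumEFin.
rewrite integral_sum//; last first.
  move=> s; apply: (@bounded_integrable _ _ _ Q
    (g \o first_coords hnN \o (Defs.tperm s \o Y))).
    apply: measurableT_comp => //; apply: measurableT_comp => //.
    exact: measurable_tperm.
  exact: bounded_real_comp.
under eq_bigr do rewrite -int_perm.
rewrite -(fineK int_fin) sumEFin/= sumr_const card_Sn.
by rewrite !lee_fin -[_ *+ _]mulr_natl normrM gtr0_norm// ger_pMr.
Qed.

Lemma extendible_ext_norm : extendible P X hnN -> ext_norm P X N = 1%E.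
Proof.
move=> extX; apply/eqP; rewrite eq_le ext_norm_ge1 andbT.
by apply: ge_ereal_sup => _ [g [mg bg gU] <-]; exact: extendible_integral_le1.
Qed.

Hypothesis norm1 : ext_norm P X N = 1%E.

(** By homogeneity: [r^-1 * g] competes in the supremum that defines the norm. *)
Lemma ext_norm_Rintegral_le (g : n.-tuple T -> R) (r : R) :
  measurable_fun setT g -> bounded_real g -> 0 < r ->
  (forall x : N.-tuple T, `|Ustat g x| <= r) ->
  `| \int[P]_w (g (X w)) | <= r.
Proof.
move=> mg [M gM] r0 gr.
have int_gX : P.-integrable setT (EFin \o (g \o X)).
  by apply: bounded_integrable; [exact: measurableT_comp|exists M => t /=].
have := @RintegralZl _ _ _ P setT (g \o X) r^-1 measurableT int_gX.
have : (`| \int[P]_w (r^-1 * g (X w))%:E | <= 1)%E.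
  rewrite -norm1; apply: ereal_sup_ubound; exists (fun t => r^-1 * g t) => //.
  split; first by apply: measurable_funM => //; exact: measurable_cst.
    exists (r^-1 * M) => t; rewrite normrM gtr0_norm ?invr_gt0//.
    by rewrite ler_pM2l ?invr_gt0.
  move=> x; rewrite /Ustat -mulr_sumr -mulrA normrM gtr0_norm ?invr_gt0//.
  by rewrite ler_pdivrMl// mulr1; exact: gr.
rewrite /Rintegral /=; set I := (\int[P]_w (_ * _)%:E)%E.
case: I => [a| |]//=; rewrite lee_fin => a1 aE.
move: a1; rewrite aE normrM gtr0_norm ?invr_gt0// ler_pdivrMl// mulr1.
exact.
Qed.

(** Turns the two-sided norm bound into the one-sided bound by the supremum that
    [positive_extension] asks for. *)
Lemma ext_norm_Rintegral_le_sup (g : n.-tuple T -> R) (M : R) :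
  measurable_fun setT g -> bounded_real g ->
  (forall x : N.-tuple T, Ustat g x <= M) ->
  \int[P]_w (g (X w)) <= M.
Proof.
move=> mg [B gB] gM; apply/ler_addgt0Pr => e e0.
(* [Ustat g] ranges over [-B, M]: centre it at the midpoint of this interval. *)
pose c := (M - B) / 2; pose r := (M + B) / 2 + e.
have gU (x : N.-tuple T) : - B <= Ustat g x <= M.
  rewrite gM andbT; have := Ustat_norm_le hnN x gB.
  by rewrite ler_norml => /andP[].
have /andP[MB1 MB2] := gU point.
have mgc : measurable_fun setT (fun t => 1 * g t - c).
  apply: measurable_funD; last exact: measurable_cst.
  by apply: measurable_funM => //; exact: measurable_cst.
have bgc : bounded_real (fun t => 1 * g t - c).
  apply: (@bounded_real_lin _ _ 1 g (fun=> - c)); first by exists B.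
  by exists `|c| => _; rewrite normrN.
(* The summand [e] keeps the radius positive when [M = - B]; since [c + r = M + e], it disappears as
   [e] tends to 0. *)
have r0 : 0 < r by rewrite /r; lra.
have : forall x : N.-tuple T, `|Ustat (fun t => 1 * g t - c) x| <= r.
  move=> x; rewrite (@Ustat_lin _ _ _ _ 1 g (fun=> - c)) (Ustat_cst hnN) mul1r.
  by have /andP[? ?] := gU x; rewrite ler_norml /r /c; apply/andP; split; lra.
move=> /(ext_norm_Rintegral_le mgc bgc r0).
under eq_Rintegral do rewrite mul1r.
rewrite RintegralB//; last first.
- exact: finite_measure_integrable_cst.
- apply: (@bounded_integrable _ _ _ P (g \o X)); first exact: measurableT_comp.
  by apply: bounded_real_comp; exists B.
rewrite Rintegral_cst//= probability_setT mulr1 ler_norml /r /c => /andP[_].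
lra.
Qed.

End extendible_norm.

(** * The symmetric finitely additive extension *)

Section finitely_additive_extension.
Context {R : realType} {d} {T : measurableType d} {n N : nat}
  (hnN : (n <= N)%N) {d'} {Omega : measurableType d'}
  (P : probability Omega R) (X : Omega -> n.-tuple T).
Hypotheses (mX : measurable_fun setT X) (norm1 : ext_norm P X N = 1%E).

(** Links two models of the power of the space: functions, which carry the product topology, and
    tuples, which carry the product sigma-algebra. *)
Definition tuple_of_fun (f : 'I_N -> T) : N.-tuple T := [tuple f i | i < N].

Lemma tuple_of_funK (x : N.-tuple T) : tuple_of_fun (tnth x) = x.
Proof. by apply: eq_from_tnth => i; rewrite tnth_mktuple. Qed.

Lemma tperm_tuple_of_fun (s : 'S_N) (f : 'I_N -> T) :
  Defs.tperm s (tuple_of_fun f) = tuple_of_fun (fun i => f (s i)).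
Proof. by apply: eq_from_tnth => i; rewrite !tnth_mktuple. Qed.

Definition sym_indic (A : set ('I_N -> T)) (f : 'I_N -> T) : R :=
  N`!%:R^-1 * \sum_(s : 'S_N) \1_A (fun i => f (s i)).

Lemma sym_indic_bounded A : bounded_real (sym_indic A).
Proof.
exists (N`!%:R^-1 * \sum_(s : 'S_N) 1) => f.
have N0 : 0 <= N`!%:R^-1 :> R by rewrite invr_ge0.
rewrite normrM ger0_norm// ler_wpM2l// (le_trans (ler_norm_sum _ _ _))//.
by apply: ler_sum => s _; rewrite indicE; case: (_ \in _); rewrite ?normr1 ?normr0.
Qed.

Lemma sym_indicT f : sym_indic setT f = 1.
Proof.
rewrite /sym_indic (eq_bigr (fun=> 1)) => [|s _]; last by rewrite indicT.
by rewrite sumr_const card_Sn mulVf// pnatr_eq0 -lt0n fact_gt0.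
Qed.

Lemma sym_indicU A B : A `&` B = set0 ->
  sym_indic (A `|` B) = fun f => 1 * sym_indic A f + sym_indic B f.
Proof.
move=> AB; apply/funext => f; rewrite mul1r /sym_indic -mulrDr -big_split/=.
congr (_ * _); apply: eq_bigr => s _; rewrite !indicE in_setU.
set h := fun i => _; case: (boolP (h \in A)) => [/set_mem Ah|_]; last by rewrite add0r.
case: (boolP (h \in B)) => [/set_mem Bh|_]; last by rewrite addr0.
by have : (A `&` B) h by []; rewrite AB.
Qed.

Lemma sym_indic_perm A (s : 'S_N) :
  sym_indic [set f | A (fun i => f (s i))] = sym_indic A.
Proof.
apply/funext => f; rewrite /sym_indic; congr (_ * _).
rewrite [RHS](reindex_inj (mulgI s)); apply: eq_bigr => t _; rewrite !indicE.
congr (_%:R); congr nat_of_bool; apply: asbool_equiv_eq => /=.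
by rewrite (_ : (fun i => f (t (s i))) = fun i => f ((s * t)%g i))//;
  apply/funext => i; rewrite permM.
Qed.

(** Places the symmetrized indicators of sets depending on the first [n] coordinates in the domain
    where the functional is prescribed; this yields the marginals of [m]. *)
Lemma sym_indic_Ustat (A : set (n.-tuple T)) (f : 'I_N -> T) :
  sym_indic [set f | A (first_coords hnN (tuple_of_fun f))] f =
  Ustat (\1_A : n.-tuple T -> R) (tuple_of_fun f).
Proof.
have N0 : N`!%:R != 0 :> R by rewrite pnatr_eq0 -lt0n fact_gt0.
apply: (mulfI N0); rewrite -(sum_perm_Ustat hnN) /sym_indic mulVKf//.
by apply: eq_bigr => s _; rewrite tperm_tuple_of_fun !indicE.
Qed.

Lemma finitely_additive_extension : exists m : set ('I_N -> T) -> R,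
  [/\ finitely_additive_probability m,
      forall (s : 'S_N) A, m [set f | A (fun i => f (s i))] = m A &
      forall A, measurable A ->
        law P X A = (m [set f | A (first_coords hnN (tuple_of_fun f))])%:E].
Proof.
(* The graph of the assignment of the expectation of [g (X w)] to [Ustat g]. Working with the graph
   leaves independence of the choice of [g] to the domination bound. *)
pose G0 : set ((('I_N -> T) -> R^o) * R) := [set x |
  exists g : n.-tuple T -> R, [/\ measurable_fun setT g, bounded_real g,
    x.1 = (fun f => Ustat g (tuple_of_fun f)) & x.2 = \int[P]_w (g (X w))]].
have intX (g : n.-tuple T -> R) : measurable_fun setT g -> bounded_real g ->
    P.-integrable setT (EFin \o (g \o X)).
  move=> mg bg; apply: bounded_integrable; first exact: measurableT_comp.
  exact: bounded_real_comp.
have [|||L [Llin Lge0 LG0]] := @positive_extension R ('I_N -> T) G0.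
- move=> a _ _ [g [mg bg -> ->]] [h [mh bh -> ->]].
  exists (fun t => a * g t + h t); split.
  + by apply: measurable_funD => //; exact: measurable_funM.
  + exact: bounded_real_lin.
  + by apply/funext => f; rewrite Ustat_lin.
  + rewrite RintegralD; last exact: (intX h mh bh).
    * by rewrite (RintegralZl _ measurableT (intX g mg bg)).
    * exact: measurableT.
    * exact: (integrableZl measurableT a (intX g mg bg)).
- exists (fun=> 1); split; first exact: measurable_cst.
  + by exists 1 => _; rewrite normr1.
  + by apply/funext => f; rewrite (Ustat_cst hnN).
  + by rewrite Rintegral_cst//= probability_setT mulr1.
- move=> x [g [mg bg -> ->]]; split.
    by move: bg => [M gM]; exists M => f; exact: (Ustat_norm_le hnN).
  move=> M gM; apply: (ext_norm_Rintegral_le_sup hnN mX norm1 mg bg) => x'.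
  by rewrite -(tuple_of_funK x').
(* Symmetrizing before applying [L] makes the set function permutation invariant, although [L]
   itself need not be. *)
exists (fun A => L (sym_indic A)); split.
- split.
  + apply: LG0; exists (fun=> 1); split; first exact: measurable_cst.
    * by exists 1 => _; rewrite normr1.
    * by apply/funext => f; rewrite (Ustat_cst hnN); exact: sym_indicT.
    * by rewrite Rintegral_cst//= probability_setT mulr1.
  + move=> A; apply: Lge0 => [|f]; first exact: sym_indic_bounded.
    by rewrite mulr_ge0 ?invr_ge0// sumr_ge0.
  + move=> A B AB; rewrite sym_indicU// Llin ?mul1r//; exact: sym_indic_bounded.
- by move=> s A; rewrite sym_indic_perm.
- move=> A mA; have mXA : measurable (X @^-1` A).
    by rewrite -[X in measurable X]setTI; exact: mX.
  rewrite (@LG0 _ (\int[P]_w (\1_A (X w)))).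
    rewrite /Rintegral fineK; last first.
      apply: integrable_fin_num => //; apply: (intX \1_A); first exact: measurable_indic.
      by exists 1 => t; rewrite indicE; case: (_ \in _); rewrite ?normr1 ?normr0.
    have := integral_indic P measurableT mXA; rewrite setIT /law => <-.
    by apply: eq_integral => w _; rewrite !indicE.
  exists \1_A; split => //.
  + by exists 1 => t; rewrite indicE; case: (_ \in _); rewrite ?normr1 ?normr0.
  + by apply/funext => f; exact: sym_indic_Ustat.
Qed.

End finitely_additive_extension.

(** * From the finitely additive extension to an exchangeable random element *)

Section countably_additive_extension.
Context {R : realType} {S : ptopologicalType} {n N : nat} (hn : (0 < n)%N)
  (hnN : (n <= N)%N) {d} {Omega : measurableType d}
  (P : probability Omega R) (X : Omega -> n.-tuple (borelType S)).
Hypotheses (hS : hausdorff_space S) (mX : measurable_fun setT X).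

Let mu := law P (fun w => tnth (X w) (Ordinal hn)).

Hypotheses (mu_or : outer_regular mu) (mu_tight : tight mu)
  (norm1 : ext_norm P X N = 1%E).

Lemma ext_norm_extendible : extendible P X hnN.
Proof.
have [m [hm m_sym mX1]] := finitely_additive_extension hnN mX norm1.
(* The transposition of [i] with the first index carries the first marginal to the [i]-th, so every
   one-dimensional marginal of [m] is the law of the first coordinate of [X]. *)
have mu_m i A : measurable A -> mu A = (m [set f | A (f i)])%:E.
  move=> mA; have := mX1 _ (measurable_coord (Ordinal hn) mA).
  rewrite -(m_sym (perm.tperm i (widen_ord hnN (Ordinal hn)))).
  rewrite /mu /law => ->; congr ((m _)%:E); apply/funext => f /=.
  by rewrite !tnth_mktuple tpermR.
pose TN := prod_topology (fun _ : 'I_N => S) : ptopologicalType.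
pose reg := @regular_set R TN m.
have m_tight := cylinders_tight hS hm mu_tight mu_m.
have reg_cyl i (A : set (borelType S)) : measurable A ->
    reg [set f : 'I_N -> S | A (f i)].
  exact: (regular_cylinder hS hm mu_or mu_tight mu_m).
have regC A : reg A -> reg (~` A).
  exact: (@regular_setC R TN m hm m_tight A).
have regI A B : reg A -> reg B -> reg (A `&` B).
  move=> rA rB; rewrite -[A `&` B]setCK setCI; apply: (regC).
  by apply: (@regular_setU R TN m hm); exact: regC.
have regT : reg setT.
  by rewrite -setC0; apply: regC; exact: (@regular_set0 R TN m hm).
have [d' [W [Q [h hQ]]]] := @regular_set_probability R TN m hm m_tight.
pose Y w : N.-tuple (borelType S) :=
  @tuple_of_fun _ (borelType S) N (h w : 'I_N -> borelType S).
have mY : measurable_fun setT Y.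
  apply/measurable_fun_tnthP => i _ A mA; rewrite setTI.
  rewrite (_ : _ @^-1` A = h @^-1` [set f : 'I_N -> borelType S | A (f i)]).
    by have [] := hQ _ (reg_cyl i _ mA).
  by apply/funext => w /=; rewrite tnth_mktuple.
exists d', W, Q, Y; split => // [s A mA|A mA].
- change (law Q (Defs.tperm s \o Y) A = law Q Y A); move: A mA.
  (* [Q] is known to agree with [m] only on regular sets, so both the set and its permuted preimage
     must be regular before the symmetry of [m] can be used. *)
  pose G := [set A : set (N.-tuple (borelType S)) |
    reg [set f : 'I_N -> borelType S | A (tuple_of_fun f)] /\
    reg [set f : 'I_N -> borelType S | A (Defs.tperm s (tuple_of_fun f))]].
  apply: (@eq_law_tuple _ _ _ _ _ _ _ Q Q N (Defs.tperm s \o Y) Y G) => //.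
  + by apply: measurableT_comp => //; exact: measurable_tperm.
  + by move=> B C [? ?] [? ?]; split; exact: regI.
  + move=> i B mB; split => /=.
      rewrite (_ : [set f | _] = [set f | B (f i)]); first exact: reg_cyl.
      by apply/funext => f /=; rewrite tnth_mktuple.
    rewrite (_ : [set f | _] = [set f | B (f (s i))]); first exact: reg_cyl.
    by apply/funext => f /=; rewrite !tnth_mktuple.
  + move=> B mB [/hQ[_ QB] /hQ[_ QsB]]; rewrite /law.
    transitivity (m [set f | B (Defs.tperm s (tuple_of_fun f))])%:E; first exact: QsB.
    transitivity (m [set f | B (tuple_of_fun f)])%:E; last by rewrite -QB.
    rewrite -[in RHS](m_sym s); congr ((m _)%:E); apply/funext => f /=.
    by rewrite tperm_tuple_of_fun.
- move: A mA.
  pose G := [set A : set (n.-tuple (borelType S)) |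
    reg [set f : 'I_N -> borelType S | A (first_coords hnN (tuple_of_fun f))]].
  apply: (@eq_law_tuple _ _ _ _ _ _ _ Q P n (first_coords hnN \o Y) X G) => //.
  + by apply: measurableT_comp => //; exact: measurable_first_coords.
  + by move=> B C ? ?; exact: regI.
  + move=> i B mB; rewrite /G/=.
    rewrite (_ : [set f | _] = [set f | B (f (widen_ord hnN i))]).
      exact: reg_cyl.
    by apply/funext => f /=; rewrite !tnth_mktuple.
  + by move=> B mB /hQ[_ QB]; rewrite mX1.
Qed.

End countably_additive_extension.

Unset Implicit Arguments.

Theorem theorem2 (R : realType) (S : ptopologicalType)
  (hS_lc : locally_compact [set: S]) (hS_T2 : hausdorff_space S)
  (n N : nat) (hn : (0 < n)%N) (hnN : (n <= N)%N)
  (d : measure_display) (Omega : measurableType d) (P : probability Omega R)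
  (X : Omega -> n.-tuple (borelType S))
  (mX : measurable_fun [set: Omega] X)
  (hexch : exchangeable_law (law P X))
  (hX1_or : outer_regular (law P (fun w => tnth (X w) (Ordinal hn))))
  (hX1_tight : tight (law P (fun w => tnth (X w) (Ordinal hn)))) :
  extendible P X hnN <-> ext_norm P X N = 1%E.
Proof.
split; first exact: extendible_ext_norm.
exact: (ext_norm_extendible hnN hS_T2 mX hX1_or hX1_tight).
Qed.
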